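(* Let $\mathcal{G}$ be an additive subgroup of $\mathbb{R}$, $n$ a positive integer, and $c,m\in\mathcal{G}$ with $c>0$, $m\geq 0$. (a) For all $k,k'\in\{0,1,\ldots,n-1\}$, there is a bijection from $\mathrm{SKF}_k$ to $\mathrm{SKF}_{k'}$. (b) When $\mathcal{G}=\mathbb{Z}$, for all $k\in\{0,1,\ldots,n-1\}$, $|\mathrm{SKF}_k|=|\mathrm{SKF}_{n-1}|=c(mn+c)^{n-1}$.
   Context: $[n]=\{1,\ldots,n\}$. For $f:[n]\to\mathcal{G}$, let $\pi(f)=\{(x_i,i):0\leq i<n\}$ where $x_0\leq x_1\leq\cdots\leq x_{n-1}$ is the list of values $f(1),\ldots,f(n)$ sorted into weakly increasing order. For $k\in\{0,\ldots,n-1\}$, $f$ is $k$-skeletal (for parameters $c,m$) iff: (P0) $x_0\geq 0$; (P1) $x_i<mi+c$ for all $i\in\{n-k-1,\ldots,n-1\}$; (P2) for every $i\in\{0,\ldots,n-k-1\}$ there exists $j\in\{i,\ldots,i+k\}$ with $x_j\geq mj$. $\mathrm{SKF}_k$ is the set of $k$-skeletal functions $f:[n]\to\mathcal{G}$. *)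

(* Defs.v *)
From HB Require Import structures.
From mathcomp Require Import all_boot all_order all_algebra.
From mathcomp Require Import all_classical all_reals.
Set Implicit Arguments.
Unset Strict Implicit.
Unset Printing Implicit Defensive.
Import Order.TTheory GRing.Theory Num.Theory.
Local Open Scope classical_set_scope.
Local Open Scope ring_scope.

(* The domain [n] = {1, ..., n} is represented by 'I_n, shifted down by one. *)

Definition sorted_val (R : realType) (n : nat) (f : {ffun 'I_n -> R})
    (i : nat) : R :=
  nth 0 (sort <=%R (codom f)) i.

(* Only used for k < n, where the truncated n - k.+1 is the integer n - k - 1
   and the index j below automatically satisfies j < n, so that sorted_val is
   never evaluated outside its range. *)
Definition skeletal (R : realType) (c m : R) (n k : nat)
    (f : {ffun 'I_n -> R}) : Prop :=
  [/\ 0 <= sorted_val f 0,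
      (forall i : nat, (n - k.+1 <= i < n)%N ->
         sorted_val f i < m * i%:R + c)
    & (forall i : nat, (i <= n - k.+1)%N ->
         exists2 j : nat, (i <= j <= i + k)%N & m * j%:R <= sorted_val f j)].

(* A function [n] -> G is encoded as an R-valued function with values in G. *)
Definition SKF (R : realType) (G : zmodClosed R) (c m : R) (n k : nat) :
    set {ffun 'I_n -> R} :=
  [set f : {ffun 'I_n -> R} | (forall i, f i \in G) /\ skeletal c m k f].

(* Main.v *)
(* Put M = m n + c and extend the sorted values to a bi-infinite sequence by
   x_(i+n) = x_i + M; call i below when x_i < m i.  A function f with values in
   [0, M) is k-skeletal iff the last run of k+1 consecutive positions below
   ends just before position 0.  Every f has a last such run, ending just
   before some p.  Subtracting m p from f modulo M translates the set of
   positions below by p, which moves this run to the origin.  Applied with k'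
   to a k-skeletal function this gives (a): the inverse is the same operation
   with k, since both functions have the same positions below up to
   translation.
   For (b), carry out the construction for f - t with t in [0, c): recording
   the total shift s = t + m p modulo M gives a bijection between pairs
   (f, t), with f arbitrary in [0, M)^n, and pairs of a k-skeletal function and
   a residue s in [0, M), as t is recovered modulo c from f and s.  Over the
   integers, M |SKF_k| = c M^n. *)
Require Import Defs.
From HB Require Import structures.
From mathcomp Require Import all_boot all_order all_algebra finmap.
From mathcomp Require Import all_classical all_reals.
From mathcomp Require Import zify ring lra.
Set Implicit Arguments.
Unset Strict Implicit.
Unset Printing Implicit Defensive.
Import Order.TTheory GRing.Theory Num.Theory.
Local Open Scope classical_set_scope.
Local Open Scope card_scope.
Local Open Scope ring_scope.

(** * Bijections and cardinalities of finite sets *)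

Lemma can2_set_bij (T U : Type) (A : set T) (B : set U) (f : T -> U)
    (g : U -> T) :
  (forall x, A x -> B (f x)) -> (forall y, B y -> A (g y)) ->
  (forall x, A x -> g (f x) = x) -> (forall y, B y -> f (g y) = y) ->
  set_bij A B f.
Proof.
move=> fAB gBA fK gK; split=> [x|x y /set_mem Ax /set_mem Ay fxy|y By].
- exact: fAB.
- by rewrite -(fK x Ax) fxy fK.
- by exists (g y); [exact: gBA|exact: gK].
Qed.

Lemma set_bij_card_eq (T U : Type) (A : set T) (B : set U) (f : T -> U) :
  set_bij A B f -> A #= B.
Proof. by move=> /Pbij[g _]; exact: pcard_eq. Qed.

Lemma cardfsM (T U : choiceType) (A : {fset T}) (B : {fset U}) :
  #|` (A `*` B)%fset| = (#|` A| * #|` B|)%N.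
Proof.
rewrite /fsetM unlock size_seq_fset undup_id ?size_allpairs ?size_enum_fset //.
by apply: allpairs_uniq => //= -[a b] [a' b'].
Qed.

Lemma card_fset_setT (T : finType) : #|` fset_set [set: T]| = #|T|.
Proof.
apply: card_fset_set; rewrite (card_eqr card_II) card_eq_sym.
apply: (@set_bij_card_eq _ _ _ _ (@enum_val T predT)).
by apply: (can2_set_bij (g := @enum_rank T)) => // x _;
  rewrite ?enum_rankK ?enum_valK.
Qed.

Section Skeletal.
Variables (R : realType) (n : nat) (c m : R).
Hypotheses (n_gt0 : (0 < n)%N) (c_gt0 : 0 < c) (m_ge0 : 0 <= m).
Implicit Types (f g : {ffun 'I_n -> R}) (s t x y : R) (i j p q z : int).

Let M : R := m * n%:R + c.

Lemma period_gt0 : 0 < M.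
Proof. by rewrite ltr_wpDl // mulr_ge0. Qed.
Let M_gt0 := period_gt0.
Let M_neq0 : M != 0. Proof. by rewrite gt_eqF. Qed.

(** * Residues modulo a positive real and translation of functions *)

Definition modr (d x : R) : R := x - d * (Num.floor (x / d))%:~R.

Lemma floor_subM x z : Num.floor ((x - M * z%:~R) / M) = Num.floor (x / M) - z.
Proof.
rewrite mulrBl mulrAC divff // mul1r -mulrNz floorDrz ?intr_int //.
by rewrite intrKfloor.
Qed.

Lemma modr_itv d x : 0 < d -> 0 <= modr d x < d.
Proof.
move=> d0; have /andP[l u] := floor_itv (x / d); rewrite /modr.
rewrite ler_pdivlMr // in l; rewrite ltr_pdivrMr // in u.
by move: u; rewrite intrD => u; apply/andP; split; nra.
Qed.

Lemma modr_id d x : 0 <= x < d -> modr d x = x.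
Proof.
move=> /andP[x0 xd]; have d0 := le_lt_trans x0 xd.
have /eqP F0 : Num.floor (x / d) == 0.
  by rewrite floor_eq add0r ler_pdivlMr // ltr_pdivrMr // mul0r mul1r x0.
by rewrite /modr F0 mulr0 subr0.
Qed.

Lemma modr_addM d x z : 0 < d -> modr d (x + d * z%:~R) = modr d x.
Proof.
move=> d0; rewrite /modr mulrDl mulrAC divff ?gt_eqF // mul1r.
by rewrite floorDrz ?intr_int // intrKfloor intrD; ring.
Qed.

Lemma modr_modDl d x y : 0 < d -> modr d (modr d x + y) = modr d (x + y).
Proof.
move=> d0; rewrite -(modr_addM (x + y) (- Num.floor (x / d)) d0) mulrNz.
by congr modr; rewrite /modr; ring.
Qed.

Lemma modr_in (G : zmodClosed R) d x : d \in G -> x \in G -> modr d x \in G.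
Proof. by move=> dG xG; rewrite /modr mulrzr rpredB // rpredMz. Qed.

Definition reduce f s : {ffun 'I_n -> R} := [ffun a => modr M (f a - s)].

Lemma reduce_reduce f s t : reduce (reduce f s) t = reduce f (s + t).
Proof.
by apply/ffunP=> a; rewrite !ffunE modr_modDl // opprD addrA.
Qed.

Lemma reduce_addM f s z : reduce f (s + M * z%:~R) = reduce f s.
Proof.
apply/ffunP=> a; rewrite !ffunE -(modr_addM (f a - s) (- z)) //.
by rewrite mulrNz; congr modr; ring.
Qed.

Definition box f := forall a, 0 <= f a < M.

Lemma reduce_box f s : box (reduce f s).
Proof. by move=> a; rewrite ffunE modr_itv. Qed.

Lemma reduce0 f : box f -> reduce f 0 = f.
Proof. by move=> bf; apply/ffunP=> a; rewrite ffunE subr0 modr_id. Qed.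

(** * The counting function of the periodic extension *)

(* The number of terms below t in the M-periodic extension of f, normalised so
   that terms of f in [0, M) count from index 0; hence x_i < t iff i < cnt f t. *)
Definition cnt f t : int := - \sum_a Num.floor ((f a - t) / M).

Lemma cnt_addM f t z : cnt f (t + M * z%:~R) = cnt f t + n%:Z * z.
Proof.
rewrite /cnt; under eq_bigr => a _.
  rewrite opprD addrA floor_subM; over.
rewrite sumrB sumr_const card_ord opprD opprK; congr (_ + _).
by rewrite -mulr_natl natz.
Qed.

Lemma cnt_le f : {homo cnt f : s t / s <= t}.
Proof.
move=> s t st; rewrite lerN2; apply: ler_sum => a _; apply: le_floor.
by rewrite ler_pM2r ?invr_gt0 // lerB.
Qed.

(** The level [s] becomes the new origin, so the term of index [cnt f s] becomes the term of index
    0. *)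
Lemma cnt_reduce f s t : cnt (reduce f s) t = cnt f (s + t) - cnt f s.
Proof.
rewrite /cnt opprK addrC -sumrB -sumrN.
apply: eq_bigr => a _; rewrite ffunE /modr.
rewrite addrAC floor_subM opprB; congr (_ - Num.floor (_ / _)).
by rewrite opprD addrA.
Qed.

(** Each value contributes one floor estimate; together with [cnt_upper] this makes [cnt f] linear
    in [t] up to a bounded error. *)
Lemma cnt_lower f t : n%:R * t - \sum_a f a <= M * (cnt f t)%:~R.
Proof.
have -> : n%:R * t - \sum_a f a = \sum_a (t - f a).
  by rewrite sumrB sumr_const card_ord mulr_natl.
rewrite mulrNz mulrN rmorph_sum /= mulr_sumr -sumrN.
apply: ler_sum => a _; have := floor_le ((f a - t) / M).
by rewrite ler_pdivlMr // => h; rewrite mulrC; lra.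
Qed.

Lemma cnt_upper f t : M * (cnt f t)%:~R <= n%:R * t - \sum_a f a + n%:R * M.
Proof.
have -> : n%:R * t - \sum_a f a + n%:R * M = \sum_a (t - f a + M).
  rewrite big_split sumrB !sumr_const card_ord /= !mulr_natl //.
rewrite mulrNz mulrN rmorph_sum /= mulr_sumr -sumrN.
apply: ler_sum => a _; have := floorD1_gt ((f a - t) / M).
by rewrite ltr_pdivrMr // intrD => h; lra.
Qed.

(** * Positions below and their last run *)

Definition below f t i : bool := i < cnt f (t + m * i%:~R).

Definition run k f t i := forall j, i - k.+1%:Z <= j < i -> below f t j.

(* p is the position following the last run of k+1 positions below. *)
Definition mark k f t p := run k f t p /\ forall i, p < i -> ~ run k f t i.

Lemma mark_uniq k f t p q : mark k f t p -> mark k f t q -> p = q.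
Proof.
move=> [rp np] [rq nq]; case: (ltgtP p q) => // pq.
- by case: (np _ pq).
- by case: (nq _ pq).
Qed.

(** At the threshold [t + m i], the quantity [M (cnt - i)] is [S - c i] up to an error of at most
    [n M]. As [c > 0], all very negative positions are below and all large ones are not, so runs
    exist and their ends are bounded above. *)
Lemma mark_exists k f t : exists p, mark k f t p.
Proof.
pose S := n%:R * t - \sum_a f a.
have lo i : c * i%:~R < S -> below f t i.
  move=> h; rewrite /below -(ltr_int R) -(ltr_pM2l M_gt0).
  apply: lt_le_trans (cnt_lower _ _); rewrite /M /S in h *; nra.
have hi i : S + n%:R * M <= c * i%:~R -> ~~ below f t i.
  move=> h; rewrite /below -leNgt -(ler_int R) -(ler_pM2l M_gt0).
  apply: le_trans (cnt_upper _ _) _; rewrite /M /S in h *; nra.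
(* The [+ 1] makes [i - 1] exceed [(S + n M) / c] whenever [U < i], so no run ends just before such
   an [i]. *)
pose L := Num.floor (S / c); pose U := Num.floor ((S + n%:R * M) / c) + 1.
have run_lo i : i <= L -> run k f t i.
  move=> iL j /andP[_ ji]; apply: lo.
  have := floor_le (S / c); rewrite -/L ler_pdivlMr // mulrC; apply: lt_le_trans.
  by rewrite ltr_pM2l // ltr_int; lia.
have run_hi i : run k f t i -> i <= U.
  move=> ri; rewrite leNgt; apply/negP => Ui.
  have := ri (i - 1); rewrite (_ : _ && _ = true); last by lia.
  move=> /(_ isT); apply/negP/hi.
  have := floorD1_gt ((S + n%:R * M) / c); rewrite -/U ltr_pdivrMr // (mulrC _ c).
  move=> /ltW /le_trans; apply; rewrite ler_pM2l // ler_int; lia.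
pose P (u : nat) := `[< run k f t (L + u%:Z) >].
have P0 : exists u, P u.
  by exists 0%N; apply/asboolP; apply: run_lo; rewrite addr0.
have Pub u : P u -> (u <= `|U - L|)%N.
  by move=> /asboolP /run_hi; lia.
case: (ex_maxnP P0 Pub) => u /asboolP ru maxu.
exists (L + u%:Z); split => // i ui ri.
have := maxu `|i - L|%N.
have -> : P `|i - L|%N.
  by apply/asboolP; rewrite (_ : _ + _ = i) //; lia.
by move=> /(_ isT); lia.
Qed.

(** If [p] were below, the run would extend to [p + 1]; and [p - 1] is below, so monotonicity of
    [cnt f] gives the other inequality. Hence reducing by [t + m p] shifts indices by exactly
    [p]. *)
Lemma mark_cnt k f t p : mark k f t p -> cnt f (t + m * p%:~R) = p.
Proof.
move=> [rp np]; apply/eqP; rewrite eq_le; apply/andP; split.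
- rewrite leNgt; apply/negP => bp; case: (np (p + 1)); first by lia.
  move=> j ?; have [jp|jp] := eqVneq j p; first by rewrite jp.
  by apply: rp; lia.
- have : below f t (p - 1) by apply: rp; lia.
  rewrite /below => h; have : p <= cnt f (t + m * (p - 1)%:~R) by lia.
  move=> /le_trans; apply; apply: cnt_le; rewrite lerD2l ler_wpM2l //.
  by rewrite ler_int; lia.
Qed.

(** Indices shift by [cnt f s]; writing [s + m i] in terms of the shifted position leaves the offset
    [s - m cnt f s]. *)
Lemma below_reduce f s i :
  below (reduce f s) 0 i = below f (s - m * (cnt f s)%:~R) (i + cnt f s).
Proof.
rewrite /below cnt_reduce ltrBrDr; congr (_ < cnt f _).
by rewrite intrD; ring.
Qed.

Lemma mark_reduce k f s q :
  mark k (reduce f s) 0 q <->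
  mark k f (s - m * (cnt f s)%:~R) (q + cnt f s).
Proof.
set p := cnt f s; set t := s - _.
have runE i : run k (reduce f s) 0 i <-> run k f t (i + p).
  split=> r j jP.
    by have := r (j - p); rewrite below_reduce -/p -/t subrK; apply; lia.
  by rewrite below_reduce; apply: r; lia.
split=> -[/runE rq nq]; split=> // i qi.
  have := nq (i - p); rewrite runE subrK; apply; lia.
by rewrite runE; apply: nq; lia.
Qed.

Lemma mark_reduce0 k f t p :
  mark k f t p -> mark k (reduce f (t + m * p%:~R)) 0 0.
Proof. by move=> mp; apply/mark_reduce; rewrite (mark_cnt mp) add0r addrK. Qed.

(** The default [0] is never taken, by [mark_exists]. *)
Definition last_run k f t : int := xget 0 [set p | mark k f t p].

Lemma last_runP k f t : mark k f t (last_run k f t).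
Proof. by apply: xgetPex; exact: mark_exists. Qed.

Lemma last_run_eq k f t p : mark k f t p -> last_run k f t = p.
Proof. by move=> mp; apply: mark_uniq mp; exact: last_runP. Qed.

(** * Skeletal functions as those marked at the origin *)

Lemma sorted_val_lt f (i : nat) t : (i < n)%N ->
  (sorted_val f i < t) = (i < #|[pred a | (f a < t)%R]|)%N.
Proof.
move=> i_n; rewrite /sorted_val; set s := sort _ _.
have s_sorted : sorted <=%R s by apply: sort_sorted; exact: le_total.
have -> : #|[pred a | f a < t]| = count (< t) s.
  rewrite count_sort codomE count_map -sum1_count big_enum_cond -sum1_card.
  by apply: eq_bigl => a; rewrite inE.
have size_s : size s = n by rewrite size_sort size_codom card_ord.
apply/idP/idP => [|/nth_count_lt]; last exact.
apply: contraTT; rewrite -leqNgt -leNgt => i_ge.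
by apply: nth_count_ge; rewrite // i_ge size_s.
Qed.

(** Every quotient [(f a - t) / M] lies in [[-1, 1)], so its floor is -1 when [f a < t] and 0
    otherwise. *)
Lemma cnt_box f t : box f -> 0 <= t <= M -> cnt f t = #|[pred a | f a < t]|%:Z.
Proof.
move=> bf /andP[t0 tM]; rewrite /cnt -sumrN -sum1_card [in RHS]big_mkcond /=.
rewrite -natz natr_sum; apply: eq_bigr => a _.
have /andP[fa0 faM] := bf a; rewrite inE.
case: ltP => fat.
  have /eqP -> : Num.floor ((f a - t) / M) == -1; last by [].
  rewrite floor_eq ler_pdivlMr // ltr_pdivrMr // addNr mul0r mulN1r; lra.
have /eqP -> : Num.floor ((f a - t) / M) == 0; last by rewrite oppr0.
rewrite floor_eq ler_pdivlMr // ltr_pdivrMr // add0r mul0r mul1r; lra.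
Qed.

Lemma sorted_val_cnt f (i : nat) t : box f -> 0 <= t <= M -> (i < n)%N ->
  (sorted_val f i < t) = (i%:Z < cnt f t).
Proof. by move=> bf tM i_n; rewrite sorted_val_lt // cnt_box. Qed.

(** P0 bounds the least value, and P1 at [i = n - 1] the greatest, since [m (n - 1) + c <= M]. *)
Lemma skeletal_box k f : skeletal c m k f -> box f.
Proof.
move=> [x0 xc _] a; apply/andP; split.
  move: x0; apply: contraTT; rewrite -!ltNge => fa0.
  by rewrite sorted_val_lt //; apply/card_gt0P; exists a.
have /xc : (n - k.+1 <= n.-1 < n)%N by lia.
apply: contraTT; rewrite -!leNgt => fa_ge.
have lastM : m * n.-1%:R + c <= M.
  by rewrite /M lerD2r ler_wpM2l // ler_nat leq_pred.
apply: le_trans lastM _; rewrite leNgt sorted_val_lt; last by lia.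
rewrite -leqNgt -ltnS prednK // -[X in (_ < X)%N](card_ord n).
apply: proper_card; apply/fintype.properP; split; first exact/fintype.subsetP.
by exists a; rewrite // inE -leNgt.
Qed.

Lemma below_box f (i : nat) : box f -> (i < n)%N ->
  below f 0 i%:Z = (sorted_val f i < m * i%:R).
Proof.
move=> bf i_n; rewrite sorted_val_cnt // /below ?add0r //.
rewrite mulr_ge0 //= /M; apply: ler_wpDr; first exact: ltW.
by rewrite ler_wpM2l // ler_nat ltnW.
Qed.

(** This reads P1 one period earlier: [m (i - n) + M = m i + c]. *)
Lemma below_subn_box f (i : nat) : box f -> (i < n)%N ->
  below f 0 (i%:Z - n%:Z) = (sorted_val f i < m * i%:R + c).
Proof.
move=> bf i_n; rewrite sorted_val_cnt //; last first.
  rewrite addr_ge0 ?mulr_ge0 ?(ltW c_gt0) //= /M lerD2r ler_wpM2l //.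
  by rewrite ler_nat ltnW.
rewrite /below; set u := 0 + _.
have -> : m * i%:R + c = u + M * 1%:~R by rewrite /u /M intrD mulrNz; ring.
by rewrite cnt_addM mulr1; lia.
Qed.

(** Going back [n] positions lowers the threshold by [m n < M], which loses at most [n] terms. *)
Lemma below_addn f t i : below f t (i + n%:Z) -> below f t i.
Proof.
rewrite /below => h.
suff : cnt f (t + m * (i + n%:Z)%:~R) <= cnt f (t + m * i%:~R) + n%:Z by lia.
have := cnt_addM f (t + m * i%:~R) 1; rewrite mulr1 => <-.
by apply: cnt_le; rewrite intrD -pmulrn mulr1z /M; move: c_gt0; lra.
Qed.

Lemma below_addMn f t i (q : nat) : below f t (i + (q * n)%:Z) -> below f t i.
Proof.
elim: q => [|q IH]; first by rewrite mul0n addr0.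
by move=> h; apply/IH/below_addn; rewrite -addrA -PoszD addnC.
Qed.

Lemma below0_box f : box f -> below f 0 0 = false.
Proof.
move=> bf; rewrite (@below_box f 0) // mulr0 sorted_val_lt //.
apply/negbTE; rewrite -leqNgt leqn0.
by apply/pred0P => a /=; have /andP[+ _] := bf a; rewrite leNgt => /negbTE.
Qed.

(* Nonnegative multiples of n are never below, so a run of nonnegative positions
   lies within one period, and translates to one in [0, n), excluded by P2. *)
Lemma skeletal_mark k f : (k < n)%N ->
  skeletal c m k f <-> box f /\ mark k f 0 0.
Proof.
move=> k_n; split=> [sk|[bf [r0 nr]]].
  have bf := skeletal_box sk; split=> //; have [x0 xc xm] := sk.
  split=> [j jP|i i_gt0 ri].
    have -> : j = `|(j + n%:Z)%R|%N%:Z - n%:Z by lia.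
    by rewrite below_subn_box //; [apply: xc|]; lia.
  have no0 : ~~ below f 0 0 by rewrite below0_box.
  have [s0|s_gt0] := leP (i - k.+1%:Z) 0.
    by move: no0; rewrite ri //; lia.
  pose s := `|(i - k.+1%:Z)%R|%N; have sE : i = (s + k.+1)%N%:Z by lia.
  have s_div := divn_eq s n; have r_n := ltn_pmod s n_gt0.
  set q := (s %/ n)%N in s_div; set r := (s %% n)%N in s_div r_n.
  have [nk|rk] := leqP n (r + k).
    have /below_addMn : below f 0 (0 + (q.+1 * n)%:Z).
      by apply: ri; rewrite sE s_div mulSn; lia.
    exact/negP.
  have [|j jP] := xm r; first by lia.
  rewrite leNgt -below_box //; last by lia.
  move/negP; apply; apply: (@below_addMn _ _ _ q).
  by apply: ri; rewrite sE s_div; lia.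
split.
- by rewrite leNgt; have := below0_box bf; rewrite (@below_box f 0) // mulr0 => ->.
- move=> i i_n; rewrite -below_subn_box //; last by lia.
  by apply: r0; lia.
- move=> i i_n.
  (* If P2 failed at [i], the positions from [i] to [i + k] would form a run ending just before
     [i + k + 1 > 0]. *)
  apply: contrapT => no_j; apply: (nr (i + k.+1)%N%:Z); first by lia.
  move=> j jP; have -> : j = `|j|%N%:Z by lia.
  rewrite below_box //; last by lia.
  rewrite ltNge; apply/negP => le_j; apply: no_j; exists `|j|%N => //; lia.
Qed.

(** * The bijections behind (a) and (b) *)

(** The count grows by [n z] and [M - m n = c]: changing [s] modulo [M] changes the offset modulo
    [c]. *)
Lemma sub_m_cnt_addM f s z :
  s + M * z%:~R - m * (cnt f (s + M * z%:~R))%:~R =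
  s - m * (cnt f s)%:~R + c * z%:~R.
Proof. by rewrite cnt_addM intrD intrM /M -pmulrn; ring. Qed.

Section Values.
Variable G : zmodClosed R.
Hypotheses (cG : c \in G) (mG : m \in G).

Let MG : M \in G.
Proof. by rewrite rpredD // mulr_natr rpredMn. Qed.

Lemma reduce_in f s : (forall a, f a \in G) -> s \in G ->
  forall a, reduce f s a \in G.
Proof. by move=> fG sG a; rewrite ffunE modr_in // rpredB. Qed.

Lemma m_mul_in z : m * z%:~R \in G. Proof. by rewrite mulrzr rpredMz. Qed.

Lemma SKF_mark k f : (k < n)%N ->
  SKF G c m k f <-> [/\ forall a, f a \in G, box f & mark k f 0 0].
Proof.
move=> k_n; split=> [[fG /(skeletal_mark f k_n)[bf mf]]|[fG bf mf]] //.
by split=> //; apply/skeletal_mark.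
Qed.

Definition align k f := reduce f (0 + m * (last_run k f 0)%:~R).

Lemma align_SKF k k' f : (k < n)%N -> (k' < n)%N ->
  SKF G c m k f -> SKF G c m k' (align k' f).
Proof.
move=> k_n k'_n /(SKF_mark f k_n)[fG bf mf]; apply/SKF_mark => //; split.
- by apply: reduce_in => //; rewrite add0r m_mul_in.
- exact: reduce_box.
- by apply: mark_reduce0; exact: last_runP.
Qed.

(** Aligning for [k'] moves the [k]-mark from 0 to [- p], so aligning for [k] then subtracts [- m p]
    and undoes the shift. *)
Lemma alignK k k' f : (k < n)%N -> SKF G c m k f -> align k (align k' f) = f.
Proof.
move=> k_n /(SKF_mark f k_n)[fG bf mf]; rewrite {2}/align.
have mp := last_runP k' f 0; set p := last_run k' f 0 in mp *.
have mq : mark k (reduce f (0 + m * p%:~R)) 0 (- p).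
  by apply/mark_reduce; rewrite (mark_cnt mp) addrK addNr.
rewrite /align (last_run_eq mq) reduce_reduce mulrNz mulrN !add0r subrr.
exact: reduce0.
Qed.

Definition boxG : set {ffun 'I_n -> R} :=
  [set f : {ffun 'I_n -> R} | (forall a, f a \in G) /\ box f].

Definition itvG (d : R) : set R := [set x | x \in G /\ 0 <= x < d].

Definition split_shift k (u : {ffun 'I_n -> R} * R) :=
  let s := u.2 + m * (last_run k u.1 u.2)%:~R in (reduce u.1 s, modr M s).

(** For [s = t + m p], [mark_cnt] gives [cnt f s = p], so [s - m cnt f s] is [t]. Knowing [s] only
    modulo [M] yields it modulo [c], which suffices for [t] in [[0, c)]. *)
Definition merge_shift (u : {ffun 'I_n -> R} * R) :=
  let f := reduce u.1 (- u.2) in (f, modr c (u.2 - m * (cnt f u.2)%:~R)).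

Lemma split_shift_bij k : (k < n)%N ->
  set_bij (boxG `*` itvG c) (SKF G c m k `*` itvG M) (split_shift k).
Proof.
move=> k_n; apply: (can2_set_bij (g := merge_shift)).
- move=> [f t] [[/= fG bf] [tG tc]]; split=> /=.
    apply/SKF_mark => //; split; last exact/mark_reduce0/last_runP.
      by apply: reduce_in; rewrite ?rpredD ?m_mul_in.
    exact: reduce_box.
  split; last exact: modr_itv.
  by apply: modr_in => //; rewrite rpredD ?m_mul_in.
- move=> [g s] [/= /(SKF_mark g k_n)[gG bg mg] [sG sM]]; split=> /=.
    by split; [apply: reduce_in; rewrite ?rpredN|exact: reduce_box].
  split; last exact: modr_itv.
  by apply: modr_in => //; rewrite rpredB ?m_mul_in.
- move=> [f t] [[/= fG bf] [tG tc]]; rewrite /split_shift /merge_shift /=.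
  have mp := last_runP k f t; set p := last_run k f t in mp *.
  set s := t + _; set z := Num.floor (s / M).
  have modE : modr M s = s + M * (- z)%:~R by rewrite mulrNz mulrN.
  have -> : reduce (reduce f s) (- modr M s) = f.
    rewrite reduce_reduce modE opprD addNKr -mulrN -mulrNz opprK.
    by rewrite -[_ * _]add0r reduce_addM reduce0.
  rewrite modE sub_m_cnt_addM (mark_cnt mp) addrK modr_addM // modr_id //.
- move=> [g s] [/= /(SKF_mark g k_n)[gG bg mg] [sG sM]].
  rewrite /split_shift /merge_shift /=; set f := reduce g (- s).
  set t0 := s - _; set z := Num.floor (t0 / c).
  (* Among the representatives of [s] modulo [M], [s'] is the one whose offset lies in [[0, c)]. *)
  pose s' := s + M * (- z)%:~R.
  have fs' : reduce f s' = g.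
    by rewrite reduce_addM reduce_reduce addNr reduce0.
  have -> : modr c t0 = s' - m * (cnt f s')%:~R.
    by rewrite sub_m_cnt_addM mulrNz mulrN.
  (* The mark of [g] at 0 becomes the mark of [f] at [cnt f s'], so the shift computed by
     [split_shift] is [s'] itself. *)
  have /mark_reduce : mark k (reduce f s') 0 0 by rewrite fs'.
  rewrite add0r => /last_run_eq ->.
  by rewrite subrK fs' modr_addM // modr_id.
Qed.

End Values.

End Skeletal.

(** * Cardinalities over the integers *)

Lemma int_itvP (R : realType) (d : nat) (x : R) :
  x \is a Num.int -> 0 <= x < d%:R -> exists a : 'I_d, a%:R = x.
Proof.
move=> /intrP[[k|k] ->] /andP[k0 kd]; last first.
  by move: k0; rewrite (ler_int R 0 (Negz k)).
by move: kd; rewrite -pmulrn ltr_nat => kd; exists (Ordinal kd).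
Qed.

Lemma natr_ord_itv (R : realType) (d : nat) (a : 'I_d) : 0 <= (a%:R : R) < d%:R.
Proof. by rewrite ler0n ltr_nat ltn_ord. Qed.

Lemma itvG_int_bij (R : realType) (G : zmodClosed R) (d : nat) :
  G =i Num.int -> set_bij [set: 'I_d] (itvG G d%:R) (fun a => a%:R).
Proof.
move=> Gint; split=> [a _|a b _ _ /eqP|x [xG xd]].
- by split; [rewrite Gint natr_int|exact: natr_ord_itv].
- by rewrite eqr_nat => /eqP /val_inj.
- by rewrite Gint in xG; have [a <-] := int_itvP xG xd; exists a.
Qed.

Lemma boxG_int_bij (R : realType) (n : nat) (c m : R) (G : zmodClosed R)
    (d : nat) : G =i Num.int -> m * n%:R + c = d%:R ->
  set_bij [set: {ffun 'I_n -> 'I_d}] (@boxG R n c m G)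
    (fun g => [ffun a => (g a)%:R]).
Proof.
move=> Gint Md; split=> [g _|g h _ _ /ffunP gh|f [fG bf]].
- split=> a; rewrite ffunE; first by rewrite Gint natr_int.
  by rewrite Md natr_ord_itv.
- apply/ffunP => a; have := gh a; rewrite !ffunE => /eqP.
  by rewrite eqr_nat => /eqP /val_inj.
- have /fin_all_exists[g gf] a : exists b : 'I_d, b%:R = f a.
    by apply: int_itvP; [rewrite -Gint|have := bf a; rewrite Md].
  by exists [ffun a => g a] => //; apply/ffunP=> a; rewrite !ffunE.
Qed.

Lemma set_bij_fset_card (T : finType) (U : choiceType) (A : set U) (f : T -> U) :
  set_bij [set: T] A f -> finite_set A /\ #|` fset_set A| = #|T|.
Proof.
move=> f_bij; have TA := set_bij_card_eq f_bij; have finA : finite_set A.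
  by rewrite -(eq_finite_set TA); exact: finite_finset.
split=> //; rewrite -card_fset_setT.
by apply/esym/fcard_eq => //; exact: finite_finset.
Qed.

Lemma SKF_int_card (R : realType) (G : zmodClosed R) (n : nat) (c m : R)
    (n_gt0 : (0 < n)%N) (cG : c \in G) (mG : m \in G)
    (c_gt0 : 0 < c) (m_ge0 : 0 <= m) (k : nat) :
  G =i Num.int -> (k < n)%N ->
  finite_set (@SKF R G c m n k) /\
  (#|` fset_set (@SKF R G c m n k)|%fset)%:R = c * (m * n%:R + c) ^+ n.-1.
Proof.
move=> Gint k_n; pose M := m * n%:R + c.
have M_gt0 : 0 < M := period_gt0 n c_gt0 m_ge0.
have toN x : x \in G -> 0 < x -> exists d : nat, x = d%:R.
  by rewrite Gint => /intrP[[d|d] ->] // /ltW; [exists d|rewrite (ler_int R 0)].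
have [d cE] := toN c cG c_gt0.
have [D ME] : exists D : nat, M = D%:R.
  by apply: toN => //; rewrite rpredD // mulr_natr rpredMn.
have [finB cardB] := set_bij_fset_card (boxG_int_bij Gint ME).
have [finc cardc] := set_bij_fset_card (itvG_int_bij d Gint).
have [finM cardM] := set_bij_fset_card (itvG_int_bij D Gint).
rewrite card_ffun !card_ord in cardB cardc cardM.
have finS : finite_set (@SKF R G c m n k).
  apply: sub_finite_set finB => f /(SKF_mark n_gt0 c_gt0 m_ge0 _ _ k_n).
  by case.
split=> //.
have eqX := set_bij_card_eq (split_shift_bij n_gt0 c_gt0 m_ge0 cG mG k_n).
rewrite -cE in finc cardc; rewrite -ME in finM cardM.
have := elimT (fcard_eq (finite_setX finB finc) (finite_setX finS finM)) eqX.
rewrite !fset_setX // !cardfsM cardB cardc cardM.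
set r := #|` fset_set (SKF _ _ _ _)|%fset => eq_card.
rewrite -/M ME cE -natrX -natrM; apply/eqP; rewrite eqr_nat.
(* The bijection gives [D ^ n * d = r * D]; the positive factor [D] is cancelled. *)
rewrite -(@eqn_pmul2r D); last by rewrite -(ltr_nat R) -ME.
by rewrite -eq_card -mulnA -expnSr prednK // mulnC.
Qed.

Theorem theorem3p4 (R : realType) (G : zmodClosed R) (n : nat) (c m : R)
    (n_gt0 : (0 < n)%N) (cG : c \in G) (mG : m \in G)
    (c_gt0 : 0 < c) (m_ge0 : 0 <= m) :
  (forall k k' : nat, (k < n)%N -> (k' < n)%N ->
     exists phi : {ffun 'I_n -> R} -> {ffun 'I_n -> R},
       set_bij (SKF G c m k) (SKF G c m k') phi)
  /\
  (G =i Num.int -> forall k : nat, (k < n)%N ->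
     [/\ finite_set (@SKF R G c m n k),
         #|` fset_set (@SKF R G c m n k)|%fset
           = #|` fset_set (@SKF R G c m n n.-1)|%fset
       & (#|` fset_set (@SKF R G c m n n.-1)|%fset)%:R
           = c * (m * n%:R + c) ^+ n.-1]).
Proof.
split=> [k k' k_n k'_n|Gint k k_n].
  exists (align c m k'); apply: (can2_set_bij (g := align c m k)) => f.
  - exact: align_SKF.
  - exact: align_SKF.
  - exact: alignK.
  - exact: alignK.
have last_n : (n.-1 < n)%N by rewrite prednK.
have [fin_k card_k] := SKF_int_card n_gt0 cG mG c_gt0 m_ge0 Gint k_n.
have [_ card_last] := SKF_int_card n_gt0 cG mG c_gt0 m_ge0 Gint last_n.
by split=> //; apply/eqP; rewrite -(eqr_nat R) card_k card_last.
Qed.
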